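(* Let $G_1,G_2,G_k$ be generators over $\Sigma_1,\Sigma_2,\Sigma_k$, respectively, with $\Sigma_1\cap\Sigma_2\subseteq\Sigma_k\subseteq\Sigma_1\cup\Sigma_2$. Let $K\subseteq L_m(G_1\| G_2\| G_k)$ be a specification such that both $K$ and its prefix closure $\overline{K}$ are conditionally decomposable with respect to $\Sigma_1,\Sigma_2,\Sigma_k$. Define \[ \sup C_k=\sup C(P_k(K),L(G_k),\Sigma_{k,u}),\qquad \sup C_{i+k}=\sup C\big(P_{i+k}(K),\,L(G_i)\parallel\overline{\sup C_k},\,\Sigma_{i+k,u}\big),\quad i=1,2. \] If $\sup C_k\subseteq P^{i+k}_k(\sup C_{i+k})$ for $i=1,2$, then $P^{1+k}_k(\sup C_{1+k})\cap P^{2+k}_k(\sup C_{2+k})$ is controllable with respect to $L(G_k)$ and $\Sigma_{k,u}$.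
   Context: An event set is a finite nonempty set $\Sigma$; a language over $\Sigma$ is a subset of the set $\Sigma^*$ of finite words, and the specification $K$ is a regular language. $\overline{L}$ denotes the prefix closure of $L$. A generator over $\Sigma$ is $G=(Q,\Sigma,f,q_0,Q_m)$ with finite nonempty state set $Q$, partial transition function $f:Q\times\Sigma\to Q$ (extended to words), initial state $q_0$, marked states $Q_m\subseteq Q$; $L(G)=\{s\in\Sigma^*: f(q_0,s)\text{ is defined}\}$ and $L_m(G)=\{s\in\Sigma^*: f(q_0,s)\in Q_m\}$. For $\Sigma_0\subseteq\Sigma$, the projection $\Sigma^*\to\Sigma_0^*$ is the homomorphism erasing events outside $\Sigma_0$ and fixing those in $\Sigma_0$. For $L_i\subseteq\Sigma_i^*$, $L_1\parallel L_2=\{w\in(\Sigma_1\cup\Sigma_2)^*: P_i(w)\in L_i,\ i=1,2\}$, where $P_i$ is the projection to $\Sigma_i^*$. $G_1\|G_2$ is the parallel composition of generators, with $L(G_1\|G_2)=L(G_1)\parallel L(G_2)$ and $L_m(G_1\|G_2)=L_m(G_1)\parallel L_m(G_2)$. The set $\Sigma_1\cup\Sigma_2$ is partitioned into controllable events $\Sigma_c$ and uncontrollable events $\Sigma_u$. Notation, for $i=1,2$: $\Sigma_{i+k}=\Sigma_i\cup\Sigma_k$; $\Sigma_{j,u}=\Sigma_j\cap\Sigma_u$ for $j\in\{k,1+k,2+k\}$; $P_k:(\Sigma_1\cup\Sigma_2)^*\to\Sigma_k^*$, $P_{i+k}:(\Sigma_1\cup\Sigma_2)^*\to\Sigma_{i+k}^*$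 and $P^{i+k}_k:\Sigma_{i+k}^*\to\Sigma_k^*$ are projections. A language $K\subseteq(\Sigma_1\cup\Sigma_2)^*$ is conditionally decomposable with respect to $\Sigma_1,\Sigma_2,\Sigma_k$ if $K=P_{1+k}(K)\parallel P_{2+k}(K)$. A language $M$ is controllable with respect to a prefix-closed language $L$ and a set of uncontrollable events $\Sigma'_u$ if $\overline{M}\Sigma'_u\cap L\subseteq\overline{M}$. $\sup C(K,L,\Sigma'_u)$ denotes the supremal controllable sublanguage of $K$: the union (which is itself controllable) of all $M\subseteq K\cap L$ controllable with respect to $L$ and $\Sigma'_u$. *)

(* Defs.v *)
From mathcomp Require Import all_boot.
From mathcomp Require Import boolp classical_sets.

Set Implicit Arguments.
Unset Strict Implicit.
Unset Printing Implicit Defensive.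

Local Open Scope classical_set_scope.

(* All event sets are finite subsets [S : {set E}] of one ambient finite type
   [E]; a word over [S] is a [seq E] all of whose letters lie in [S]. *)

Definition words (E : finType) (S : {set E}) : set (seq E) :=
  [set w | {subset w <= S}].

(* Every projection between sub-alphabets with target [S0]-words (whatever its
   source alphabet) is a restriction of this one function. *)
Definition proj (E : finType) (S0 : {set E}) (w : seq E) : seq E :=
  [seq e <- w | e \in S0].

Definition prefix_closure (E : finType) (L : set (seq E)) : set (seq E) :=
  [set s | exists t, L (s ++ t)].

Definition lang_par (E : finType) (S1 S2 : {set E}) (L1 L2 : set (seq E)) :
    set (seq E) :=
  [set w | [/\ words (S1 :|: S2) w, L1 (proj S1 w) & L2 (proj S2 w)]].

Record generator (E : finType) (S : {set E}) := Generator {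
  state : finType;
  step : state -> E -> option state;
  step_dom : forall q e, step q e -> e \in S;
  init : state;
  marked : {set state}
}.

Definition run_from (E : finType) (S : {set E}) (G : generator S)
    (q : option (state G)) (w : seq E) : option (state G) :=
  foldl (fun oq e => obind (fun q' => step q' e) oq) q w.

Definition run (E : finType) (S : {set E}) (G : generator S) (w : seq E) :
    option (state G) :=
  run_from (Some (init G)) w.

Definition gen_lang (E : finType) (S : {set E}) (G : generator S) :
    set (seq E) :=
  [set w | run G w].

Definition marked_lang (E : finType) (S : {set E}) (G : generator S) :
    set (seq E) :=
  [set w | exists2 q, run G w = Some q & q \in marked G].

Definition regular (E : finType) (S : {set E}) (L : set (seq E)) : Prop :=
  exists G : generator S, marked_lang G = L.

(* A component does not move on events outside its own event set. *)
Definition local_step (E : finType) (S : {set E}) (G : generator S)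
    (q : state G) (e : E) : option (state G) :=
  if e \in S then step q e else Some q.

Definition par_step (E : finType) (S1 S2 : {set E}) (G1 : generator S1)
    (G2 : generator S2) (q : state G1 * state G2) (e : E) :
    option (state G1 * state G2)%type :=
  if e \in S1 :|: S2 then
    if (local_step q.1 e, local_step q.2 e) is (Some q1, Some q2)
    then Some (q1, q2) else None
  else None.

Lemma par_step_dom (E : finType) (S1 S2 : {set E}) (G1 : generator S1)
    (G2 : generator S2) (q : state G1 * state G2) (e : E) :
  par_step q e -> e \in S1 :|: S2.
Proof. by rewrite /par_step; case: ifP. Qed.

Definition gen_par (E : finType) (S1 S2 : {set E}) (G1 : generator S1)
    (G2 : generator S2) : generator (S1 :|: S2) :=
  @Generator E (S1 :|: S2) (state G1 * state G2)%type
    (@par_step E S1 S2 G1 G2) (@par_step_dom E S1 S2 G1 G2)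
    (init G1, init G2) (finset.setX (marked G1) (marked G2)).

Lemma run_from_None (E : finType) (S : {set E}) (G : generator S) w :
  run_from (None : option (state G)) w = None.
Proof. by elim: w. Qed.

Lemma run_from_par (E : finType) (S1 S2 : {set E}) (G1 : generator S1)
    (G2 : generator S2) w q1 q2 r1 r2 :
  run_from (G := gen_par G1 G2) (Some (q1, q2)) w = Some (r1, r2) <->
  [/\ words (S1 :|: S2) w, run_from (Some q1) (proj S1 w) = Some r1 &
      run_from (Some q2) (proj S2 w) = Some r2].
Proof.
have wordsC e v : words (S1 :|: S2) (e :: v) <->
    e \in S1 :|: S2 /\ words (S1 :|: S2) v.
  split=> [H|[He Hv] x].
    by split=> [|x xv]; apply: H; rewrite inE ?eqxx ?xv ?orbT.
  by rewrite inE => /predU1P[-> //|]; apply: Hv.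
elim: w q1 q2 => [|e w IH] q1 q2.
  by rewrite /run_from /=; split=> [[-> ->]|[_ [->] [->]]].
have -> : run_from (G := gen_par G1 G2) (Some (q1, q2)) (e :: w) =
          run_from (G := gen_par G1 G2) (par_step (q1, q2) e) w by [].
have projE (S : {set E}) (G : generator S) (q : state G) :
    run_from (Some q) (proj S (e :: w)) =
    run_from (local_step q e) (proj S w).
  by rewrite /proj /local_step /=; case: ifP.
rewrite !projE /par_step; case: ifP => [eS|eNS]; last first.
  by rewrite run_from_None; split=> // -[/wordsC[]]; rewrite eNS.
case: (local_step _ e) => [q1'|] /=; last first.
  by rewrite !run_from_None; split=> // -[].
case: (local_step _ e) => [q2'|] /=; last first.
  by rewrite !run_from_None; split=> // -[].
rewrite IH; split=> [[Hw H1 H2]|[/wordsC[_ Hw] H1 H2]] //.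
by split=> //; apply/wordsC.
Qed.

Lemma gen_lang_par (E : finType) (S1 S2 : {set E}) (G1 : generator S1)
    (G2 : generator S2) :
  gen_lang (gen_par G1 G2) = lang_par S1 S2 (gen_lang G1) (gen_lang G2).
Proof.
apply/seteqP; split=> w; rewrite /gen_lang /lang_par /run /=.
  case Hr: (run_from _ w) => [[r1 r2]|] // _.
  by have [Hw -> ->] := (run_from_par w _ _ r1 r2).1 Hr.
case=> Hw; case H1: (run_from _ (proj S1 w)) => [r1|] // _.
case H2: (run_from _ (proj S2 w)) => [r2|] // _.
by rewrite ((run_from_par w _ _ r1 r2).2 _).
Qed.

Lemma marked_lang_par (E : finType) (S1 S2 : {set E}) (G1 : generator S1)
    (G2 : generator S2) :
  marked_lang (gen_par G1 G2) =
  lang_par S1 S2 (marked_lang G1) (marked_lang G2).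
Proof.
apply/seteqP; split=> w; rewrite /marked_lang /lang_par /run /=.
  case=> -[r1 r2] /run_from_par[Hw H1 H2]; rewrite inE /= => /andP[m1 m2].
  by split=> //; [exists r1|exists r2].
case=> Hw [r1 H1 m1] [r2 H2 m2]; exists (r1, r2); last by rewrite inE m1.
exact/run_from_par.
Qed.

Definition conditionally_decomposable (E : finType) (S1 S2 Sk : {set E})
    (K : set (seq E)) : Prop :=
  K = lang_par (S1 :|: Sk) (S2 :|: Sk)
        (proj (S1 :|: Sk) @` K) (proj (S2 :|: Sk) @` K).

Definition controllable (E : finType) (M L : set (seq E)) (U : {set E}) :
    Prop :=
  [set rcons s u | s in prefix_closure M & u in [set` U]] `&` L
    `<=` prefix_closure M.

Definition supC (E : finType) (K L : set (seq E)) (U : {set E}) :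
    set (seq E) :=
  \bigcup_(M in [set M | M `<=` K `&` L /\ controllable M L U]) M.

(* Main.v *)
Require Import Defs.
From mathcomp Require Import all_boot.
From mathcomp Require Import boolp classical_sets.

Local Open Scope classical_set_scope.

(** Controllability of a language depends only on its prefix closure, and the
    intersection in question turns out to have the same prefix closure as
    [supCk].  It contains [supCk] by the two inclusion hypotheses.
    Conversely, [supC1k] is computed relative to a plant in which
    [prefix_closure supCk] is one of the synchronized components, so erasing
    the events outside [Sk] from a word of [supC1k] leaves a word of
    [prefix_closure supCk].  The intersection is thus sandwiched between
    [supCk] and its prefix closure ([controllable_sandwich]), and [supCk],
    being a supremal controllable sublanguage, is controllable
    ([supC_controllable]). *)

Lemma prefix_closureS (E : finType) (M N : set (seq E)) :
  M `<=` N -> prefix_closure M `<=` prefix_closure N.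
Proof. by move=> MN s [t Mst]; exists t; apply: MN. Qed.

Lemma prefix_closure_idem (E : finType) (M : set (seq E)) :
  prefix_closure (prefix_closure M) = prefix_closure M.
Proof.
apply/seteqP; split=> s [t]; last by exists t, [::]; rewrite cats0.
by case=> t' Mstt'; exists (t ++ t'); rewrite catA.
Qed.

(** A language between [M] and its prefix closure has the same prefix closure
    as [M], which is all that controllability sees. *)
Lemma controllable_sandwich (E : finType) (M N L : set (seq E)) (U : {set E}) :
  M `<=` N -> N `<=` prefix_closure M ->
  controllable M L U -> controllable N L U.
Proof.
move=> MN NM; rewrite /controllable.
suff -> : prefix_closure N = prefix_closure M by [].
apply/seteqP; split; last exact: prefix_closureS.
by rewrite -[X in _ `<=` X]prefix_closure_idem; apply: prefix_closureS.
Qed.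

(** Any prefix of a word of a union is a prefix of a word of one member, so the
    controllability of that member already supplies the required extension. *)
Lemma supC_controllable (E : finType) (K L : set (seq E)) (U : {set E}) :
  controllable (supC K L U) L U.
Proof.
move=> _ [[s [t [M Mctrl Mst]] [u Uu <-]] Lsu].
apply: (@prefix_closureS _ M); first by move=> w Mw; exists M.
by apply: Mctrl.2; split=> //; exists s; [exists t | exists u].
Qed.

Lemma supC_sub_plant (E : finType) (K L : set (seq E)) (U : {set E}) :
  supC K L U `<=` L.
Proof. by move=> w [M [MKL _] /MKL[]]. Qed.

Theorem proposition5 (E : finType) (S1 S2 Sk Sc Su : {set E})
  (S1_ne : (0 < #|S1|)%N) (S2_ne : (0 < #|S2|)%N) (Sk_ne : (0 < #|Sk|)%N)
  (G1 : generator S1) (G2 : generator S2) (Gk : generator Sk)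
  (Sk_ge : S1 :&: S2 \subset Sk) (Sk_le : Sk \subset S1 :|: S2)
  (Scu_cover : Sc :|: Su = S1 :|: S2) (Scu_disj : Sc :&: Su = finset.set0)
  (K : set (seq E)) (K_reg : regular (S1 :|: S2) K)
  (K_spec : K `<=` marked_lang (gen_par (gen_par G1 G2) Gk))
  (K_cd : conditionally_decomposable S1 S2 Sk K)
  (K_pcd : conditionally_decomposable S1 S2 Sk (prefix_closure K)) :
  let supCk := supC (proj Sk @` K) (gen_lang Gk) (Sk :&: Su) in
  let supC1k := supC (proj (S1 :|: Sk) @` K)
                  (lang_par S1 Sk (gen_lang G1) (prefix_closure supCk))
                  ((S1 :|: Sk) :&: Su) in
  let supC2k := supC (proj (S2 :|: Sk) @` K)
                  (lang_par S2 Sk (gen_lang G2) (prefix_closure supCk))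
                  ((S2 :|: Sk) :&: Su) in
  supCk `<=` proj Sk @` supC1k ->
  supCk `<=` proj Sk @` supC2k ->
  controllable ((proj Sk @` supC1k) `&` (proj Sk @` supC2k))
    (gen_lang Gk) (Sk :&: Su).
Proof.
move=> supCk supC1k supC2k sub1 sub2.
apply: (@controllable_sandwich _ supCk); last exact: supC_controllable.
  by move=> w supCk_w; split; [apply: sub1 | apply: sub2].
by move=> _ [[w /supC_sub_plant[_ _ supCk_w] <-] _].
Qed.
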